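(* Let $(X,\|\cdot\|)$ be a real normed space and let $\sigma$ be a Hausdorff topology on $X$ coarser than the norm topology, such that the closed unit ball $B_X$ is sequentially $\sigma$-compact and also $\sigma$-compact. Let $K$ be a nonempty $\sigma$-closed and convex subset of $X$. Let $f:K\to\mathbb{R}$ be bounded from below and let $f|_{K_n}$ be $\sigma$-transfer lower continuous for each $n\in\mathbb{N}$. Suppose that for every $u\in K^\infty_\sigma\setminus\{0\}$, $f^{\sigma g}(u)>f^{\sigma g}(0)$. Then the problem of minimizing $f$ over $K$ has a solution and $(\mathrm{argmin}(f,K))^\infty_\sigma=\{0\}$, provided the following condition holds: if there exists an unbounded sequence $(x_n)$ such that $x_n\in \mathrm{argmin}(f,K_n)$ for each $n\in\mathbb{N}$, then there exist a subsequence $(n_k)$ of $(n)$, a sequence $(w_k)\subseteq K$ and $0\ne d\in K^\infty_\sigma$ such that for each $k\in\mathbb{N}$, $w_k\in\mathrm{argmin}(f,K_{n_k})$, and $\frac{w_k}{\|w_k\|}\xrightarrow{\sigma}d$ as $k\to\infty$.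
   Context: Notation. $K_n:=\{x\in K:\|x\|\le n\}$ for $n\in\mathbb{N}=\{1,2,\dots\}$. For $A\subseteq K$, $\mathrm{argmin}(f,A):=\{\bar x\in A: f(\bar x)\le f(y)\ \ \forall y\in A\}$. $x_k\xrightarrow{\sigma}x$ denotes convergence in the topology $\sigma$. Asymptotic cone. For $A\subseteq X$, $A^\infty_\sigma:=\{u\in X:\ \exists\, t_k\to+\infty \text{ and } (x_k)\subseteq A \text{ with } \frac{x_k}{t_k}\xrightarrow{\sigma}u\}$, and $\emptyset^\infty_\sigma=\emptyset$. $\sigma g$-asymptotic function. For a proper function $f:X\to\mathbb{R}\cup\{+\infty\}$ (i.e. not identically $+\infty$), $[f\le\lambda]:=\{x: f(x)\le\lambda\}$ and $f^{\sigma g}(u):=\inf\{\lambda\in\mathbb{R}: u\in([f\le\lambda])^\infty_\sigma\}$ for $u\in X$ (with $\inf\emptyset=+\infty$). A function defined only on $K$ is extended by $+\infty$ on $X\setminus K$ before forming $f^{\sigma g}$. Transfer lower continuity. For $A\subseteq X$, a function $g:A\to\mathbb{R}$ is $\sigma$-transfer lower continuous if for every $x_0\in A$: whenever $g(x_0)>g(y)$ for some $y\in A$, there exist $x'\in A$ and a (relative) $\sigma$-neighborhood $\mathcal{V}_\sigma(x_0)\subseteq A$ of $x_0$ such that $g(x)>g(x')$ for all $x\in\mathcal{V}_\sigma(x_0)$.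
   Formalization: The topology σ is also assumed to make x ↦ cx σ-continuous for every c > 0 (true for vector topologies), and in the final condition x_n ∈ argmin(f,K_n) is required only for those n with K_n nonempty; without either change the claim is false. *)

(* Defs.v *)
From HB Require Import structures.
From mathcomp Require Import all_boot all_order all_algebra.
From mathcomp Require Import all_classical all_reals all_analysis.

Set Implicit Arguments.
Unset Strict Implicit.
Unset Printing Implicit Defensive.

Import Order.TTheory GRing.Theory Num.Theory.
Import numFieldNormedType.Exports.

Local Open Scope classical_set_scope.
Local Open Scope ring_scope.

(* A topology on the type X, possibly besides a canonical one: the class of a
   topologicalType with carrier X. The choice structure that the class also
   carries plays no role. [tspace sigma] is X equipped with sigma; its carrier
   is convertible to X, so a topological notion of a set A : set X always names
   [tspace sigma] explicitly when sigma, and not the norm topology, is meant. *)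
Definition topology_on (X : Type) := Topological.axioms_ X.

Definition tspace (X : Type) (sigma : topology_on X) : topologicalType :=
  Topological.Pack sigma.

Definition seq_cvg (T : topologicalType) (x : nat -> T) (l : T) : Prop :=
  x @ \oo --> l.

Definition seq_compact (T : topologicalType) (A : set T) : Prop :=
  forall x : nat -> T, (forall n, A (x n)) ->
    exists (phi : nat -> nat) (l : T),
      [/\ {homo phi : i j / (i < j)%N}, A l & seq_cvg (x \o phi) l].

(* Only the values of g on A matter; [within A (nbhs x0)] is the filter of
   relative neighborhoods of x0 in A. *)
Definition transfer_lower_continuous (R : realType) (T : topologicalType)
    (A : set T) (g : T -> R) : Prop :=
  forall x0, A x0 -> (exists2 y, A y & g y < g x0) ->
    exists2 x', A x' & \forall x \near within A (nbhs x0), g x' < g x.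

Definition argmin (R : realType) (X : Type) (f : X -> R) (A : set X) : set X :=
  [set x | A x /\ forall y, A y -> f x <= f y].

Section NormedSpace.
Context {R : realType} {X : normedModType R}.
Implicit Types (sigma : topology_on X) (A K : set X).

Definition norm_ball (r : R) : set X := [set x | `|x| <= r].

Definition truncation K (n : nat) : set X := K `&` norm_ball n%:R.

Definition coarser_than_norm sigma : Prop :=
  forall A, @open (tspace sigma) A -> @open X A.

Definition dilation sigma (c : R) : tspace sigma -> tspace sigma :=
  fun x : X => c *: x.

(* Compatibility of sigma with positive scaling; it holds for every vector
   topology. Closed balls of any radius then inherit the compactness properties
   of the unit ball. *)
Definition dilation_continuous sigma : Prop :=
  forall c : R, 0 < c -> continuous (@dilation sigma c).

Definition asymptotic_cone sigma A : set X :=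
  [set u | exists (t : nat -> R) (x : nat -> X),
    [/\ t @ \oo --> +oo, (forall k, A (x k)) &
        @seq_cvg (tspace sigma) (fun k => (t k)^-1 *: x k) u]].

Definition sublevel (h : X -> \bar R) (l : R) : set X :=
  [set x | (h x <= l%:E)%E].

Definition asymptotic_fun sigma (h : X -> \bar R) (u : X) : \bar R :=
  ereal_inf [set l%:E | l in [set l : R | asymptotic_cone sigma (sublevel h l) u]].

Definition extend K (f : X -> R) : X -> \bar R :=
  patch (cst +oo%E) K (EFin \o f).

(* The sequences are indexed by n >= 1, the value x 0 being irrelevant. If K
   does not meet the unit ball then argmin f (truncation K n) is empty for the
   first few n, so x n is only constrained once truncation K n is nonempty. *)
Definition unbounded_argmin_condition sigma K (f : X -> R) : Prop :=
  (exists x : nat -> X,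
     ~ bounded_fun x /\
     forall n, (0 < n)%N -> truncation K n !=set0 ->
       argmin f (truncation K n) (x n)) ->
  exists (phi : nat -> nat) (w : nat -> X) (d : X),
    [/\ {homo phi : i j / (i < j)%N} /\ (forall k, (0 < phi k)%N),
        (forall k, K (w k)),
        d != 0 /\ asymptotic_cone sigma K d,
        (forall k, argmin f (truncation K (phi k)) (w k)) &
        @seq_cvg (tspace sigma) (fun k => `|w k|^-1 *: w k) d].

End NormedSpace.

(* Main.v *)
Require Import Defs.
From HB Require Import structures.
From mathcomp Require Import all_boot all_order all_algebra.
From mathcomp Require Import all_classical all_reals all_analysis.

Set Implicit Arguments.
Unset Strict Implicit.
Unset Printing Implicit Defensive.

Import Order.TTheory GRing.Theory Num.Theory.
Import numFieldNormedType.Exports.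

Local Open Scope classical_set_scope.
Local Open Scope ring_scope.

(** The constrained problems on the truncations K_n always have solutions, and
    the growth hypothesis on the asymptotic function prevents these solutions
    from escaping to infinity.

    Closed balls are sigma-compact, because they are dilations of the unit ball.
    So every K_n is sigma-compact, and a transfer lower continuous function
    attains its minimum on it: [compact_argmin] is the transfer version of
    Weierstrass' theorem. Pick a minimizer x_n on each nonempty K_n. If one
    ball contains minimizers of infinitely many truncated problems, then f comes
    as low inside this ball as anywhere on K, and a minimizer of f on the
    truncation by this ball is global: [argmin_of_bounded_argmins]. If (x_n) is
    bounded, this already gives a solution. If (x_n) is unbounded, the condition
    provides truncated minimizers w_k with w_k / |w_k| --> d and d != 0, and
    either infinitely many w_k lie in one ball, with the same conclusion, or
    |w_k| --> +oo. In the latter case every nonempty sublevel set of f contains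
    a tail of (w_k), so d is an asymptotic direction of all nonempty sublevel
    sets.

    A nonzero direction of this kind cannot exist. Since 0 is an asymptotic
    direction of precisely the nonempty sets, the infimum that defines the
    asymptotic function at 0 ranges over the levels of nonempty sublevel sets,
    so the asymptotic function at such a direction is at most its value at 0
    ([asymptotic_fun_le0]), against the hypothesis. The same remark gives the
    asymptotic cone of the solution set, which is contained in every nonempty
    sublevel set. *)

(** * Minimization on compact sets *)

(** The sets of points of A where g is at most g a, for a in A, form a filter
    base since they are nested. A cluster point that is not a minimizer would
    have, by transfer lower continuity, a neighborhood disjoint from one of
    them. *)
Lemma compact_argmin (R : realType) (T : topologicalType) (A : set T)
    (g : T -> R) :
  compact A -> A !=set0 -> transfer_lower_continuous A g -> argmin g A !=set0.
Proof.
move=> cA [a Aa] tlc.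
pose B (b : T) := [set x | A x /\ g x <= g b].
have FB : ProperFilter (filter_from A B).
  apply: filter_from_proper; last by move=> b Ab; exists b; split.
  apply: filter_from_filter; first by exists a.
  move=> b c Ab Ac; case: (leP (g b) (g c)) => bc.
    by exists b => // x [Ax xb]; split; split => //; exact: le_trans bc.
  by exists c => // x [Ax xc]; split; split => //; exact: le_trans (ltW bc).
have FA : filter_from A B A by exists a => // x [].
have [x0 [Ax0 clx0]] := cA _ FB FA.
exists x0; split => // y Ay; rewrite leNgt; apply/negP => yx0.
have [x' Ax' nx'] := tlc x0 Ax0 (ex_intro2 _ _ y Ay yx0).
have [z [[Az zx'] lez]] := clx0 (B x') _ (ex_intro2 _ _ x' Ax' (fun _ h => h)) nx'.
by have := lez Az; rewrite ltNge zx'.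
Qed.

Lemma argmin_superset (R : realType) (T : Type) (g : T -> R) (A B : set T) z :
    A `<=` B -> (forall y, B y -> exists2 w, A w & g w <= g y) ->
  argmin g A z -> argmin g B z.
Proof.
move=> AB low [Az minz]; split=> [|y /low[w Aw]]; first exact: AB.
exact: le_trans (minz _ Aw).
Qed.

(** * Truncated problems *)

Section NormedSpace.
Context {R : realType} {X : normedModType R}.
Implicit Types (sigma : topology_on X) (A K : set X) (f : X -> R).

Lemma truncation_compact sigma K (n : nat) :
    dilation_continuous sigma -> @compact (tspace sigma) (norm_ball 1 : set X) ->
    @closed (tspace sigma) K -> (0 < n)%N ->
  @compact (tspace sigma) (truncation K n).
Proof.
move=> dil cB clK n0.
have nR0 : 0 < n%:R :> R by rewrite ltr0n.
have -> : truncation K n =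
    (@dilation R X sigma n%:R @` (norm_ball 1 : set X)) `&` K.
  rewrite /truncation setIC; congr (_ `&` _); apply/seteqP; split=> x /=.
    rewrite /norm_ball /= => xn; exists (n%:R^-1 *: x).
      rewrite /= normrZ ger0_norm ?invr_ge0 ?ler0n//.
      by rewrite ler_pdivrMl// mulr1.
    by rewrite /dilation scalerA divff ?scale1r// gt_eqF.
  move=> [y y1 <-]; rewrite /norm_ball /dilation /= normrZ ger0_norm ?ler0n//.
  by rewrite ler_piMr// ler0n.
apply: compact_closedI => //.
apply: (@continuous_compact (tspace sigma) (tspace sigma)) => //.
by apply: continuous_subspaceT; exact: dil.
Qed.

Lemma truncation_subset K (m n : nat) :
  (m <= n)%N -> truncation K m `<=` truncation K n.
Proof.
by move=> mn x [Kx xm]; split => //; apply: le_trans xm _; rewrite ler_nat.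
Qed.

Lemma truncation_mem K (x : X) (M : R) :
  K x -> exists2 n, truncation K n x & M <= n%:R.
Proof.
move=> Kx; exists (Num.truncn (Num.max `|x| M)).+1.
  split => //; apply: ltW; apply: le_lt_trans (truncnS_gt _).
  by rewrite le_max lexx.
by apply: ltW; apply: le_lt_trans (truncnS_gt _); rewrite le_max lexx orbT.
Qed.

(** Every y in K belongs to K_n for large n, hence some truncated minimizer of
    norm at most M does at least as well as y. So a minimizer on a truncation
    of radius at least M is global. *)
Lemma argmin_of_bounded_argmins K f (M : R) :
    (forall n, (0 < n)%N -> truncation K n !=set0 ->
       argmin f (truncation K n) !=set0) ->
    K !=set0 ->
    (forall m : nat, exists n w,
       [/\ (m <= n)%N, argmin f (truncation K n) w & `|w| <= M]) ->
  argmin f K !=set0.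
Proof.
move=> exmin [a Ka] bnd.
have [N [_ aN] MN] := truncation_mem (Num.max M 1) Ka.
move: MN; rewrite ge_max => /andP[MN N1].
have N0 : (0 < N)%N by rewrite -(@ltr0n R) (lt_le_trans ltr01).
have [z minz] := exmin N N0 (ex_intro _ a (conj Ka aN)).
exists z; apply: argmin_superset minz => [x []//|y Ky].
have [m my _] := truncation_mem 0 Ky.
have [n [w [mn [[Kw _] minw] wM]]] := bnd m.
exists w; first by split => //; apply: le_trans MN.
exact/minw/(truncation_subset mn).
Qed.

(** * Asymptotic directions *)

Lemma asymptotic_cone_sub sigma A B :
  A `<=` B -> asymptotic_cone sigma A `<=` asymptotic_cone sigma B.
Proof.
by move=> AB u [t [x [tt Ax xu]]]; exists t, x; split => // k; exact: AB.
Qed.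

Lemma asymptotic_cone_nonempty sigma A u : asymptotic_cone sigma A u -> A !=set0.
Proof. by move=> [t [x [_ Ax _]]]; exists (x 0%N). Qed.

Lemma asymptotic_cone0 sigma A :
  coarser_than_norm sigma -> A !=set0 -> asymptotic_cone sigma A 0.
Proof.
move=> coarse [a Aa]; exists (fun k => k.+1%:R), (fun=> a); split => //.
  apply/cvgryPge => M; near=> k; apply: (@le_trans _ _ k%:R).
    by near: k; exact: nbhs_infty_ger.
  by rewrite ler_nat.
have cvg0 : (fun k : nat => k.+1%:R^-1 *: a) @ \oo --> (0 : X).
  by rewrite -(scale0r a); apply: cvgZr_tmp; exact: cvg_harmonic.
move=> U; rewrite nbhsE => -[V [oV V0] VU].
apply: filterS VU _; apply: cvg0; apply: open_nbhs_nbhs; split => //.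
exact: coarse.
Unshelve. all: by end_near. Qed.

(** A tail of the sequence lies in A, and its norms serve as scaling factors. *)
Lemma asymptotic_cone_normalized sigma A (w : nat -> X) d :
    (\forall k \near \oo, A (w k)) -> (fun k => `|w k|) @ \oo --> +oo ->
    @seq_cvg (tspace sigma) (fun k => `|w k|^-1 *: w k) d ->
  asymptotic_cone sigma A d.
Proof.
move=> [N _ Aw] wy wd.
exists (fun k => `|w (k + N)%N|), (fun k => w (k + N)%N); split.
- by apply: (cvg_comp (fun k => k + N)%N (fun k => `|w k|)) wy; exact: cvg_addnr.
- by move=> k; apply: Aw; rewrite /= leq_addl.
- apply: (@cvg_comp _ _ (tspace sigma) (fun k => k + N)%N
    (fun k => `|w k|^-1 *: w k)) wd.
  exact: cvg_addnr.
Qed.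

Lemma sublevel_extend K f (l : R) :
  sublevel (extend K f) l = [set x | K x /\ f x <= l].
Proof.
apply/seteqP; split=> x; rewrite /sublevel /extend /patch /=.
  by case: ifPn => [/set_mem Kx|_]; rewrite ?leye_eq// lee_fin.
by move=> [Kx fx]; rewrite mem_set// lee_fin.
Qed.

(** A sublevel set having 0 as an asymptotic direction is nonempty, so it
    contains the sublevel set at height f y for some y in K. *)
Lemma asymptotic_fun_le0 sigma K f u :
    (forall y, K y -> asymptotic_cone sigma [set x | K x /\ f x <= f y] u) ->
  (asymptotic_fun sigma (extend K f) u <= asymptotic_fun sigma (extend K f) 0%R)%E.
Proof.
move=> conu; apply: le_ereal_inf => _ [l l0 <-]; exists l => //=.
move: l0; rewrite /= sublevel_extend => /asymptotic_cone_nonempty[y [Ky yl]].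
apply: asymptotic_cone_sub (conu y Ky) => x [Kx xy]; split => //.
exact: le_trans yl.
Qed.

End NormedSpace.

(** * Existence of solutions and directions of the solution set *)

Theorem theorem3 (R : realType) (X : normedModType R) (sigma : topology_on X)
    (K : set X) (f : X -> R) :
  hausdorff_space (tspace sigma) ->
  coarser_than_norm sigma ->
  dilation_continuous sigma ->
  @seq_compact (tspace sigma) (norm_ball 1 : set X) ->
  @compact (tspace sigma) (norm_ball 1 : set X) ->
  K !=set0 ->
  @closed (tspace sigma) K ->
  @convex_set R X K ->
  has_lbound (f @` K) ->
  (forall n, (0 < n)%N ->
    @transfer_lower_continuous R (tspace sigma) (truncation K n) f) ->
  (forall u, asymptotic_cone sigma K u -> u != 0 ->
    (asymptotic_fun sigma (extend K f) 0%R < asymptotic_fun sigma (extend K f) u)%E) ->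
  unbounded_argmin_condition sigma K f ->
  argmin f K !=set0 /\ asymptotic_cone sigma (argmin f K) = [set 0].
Proof.
move=> _ coarse dil _ cB K0 clK _ _ tlc grow cond.
have nodir u : u != 0 ->
    (forall y, K y -> asymptotic_cone sigma [set x | K x /\ f x <= f y] u) ->
    False.
  move=> u0 conu; have [a Ka] := K0.
  have Ku : asymptotic_cone sigma K u.
    by apply: asymptotic_cone_sub (conu a Ka) => x [].
  by have := grow u Ku u0; rewrite ltNge asymptotic_fun_le0.
have exmin n : (0 < n)%N -> truncation K n !=set0 ->
    argmin f (truncation K n) !=set0.
  move=> n0 Kn0; apply: (@compact_argmin R (tspace sigma)) => //.
    exact: truncation_compact.
  exact: tlc.
have sol : argmin f K !=set0.
  have /choice[x xmin] : forall n : nat, exists x : X,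
      (0 < n)%N -> truncation K n !=set0 -> argmin f (truncation K n) x.
    move=> n; have [[n0 Kn0]|nK] := pselect ((0 < n)%N /\ truncation K n !=set0).
      by have [x] := exmin n n0 Kn0; exists x.
    by exists 0 => n0 Kn0; case: nK.
  have [[M [_ xM]]|unb] := pselect (bounded_fun x).
    have [a Ka] := K0; have [N Na _] := truncation_mem 0 Ka.
    apply: (@argmin_of_bounded_argmins R X K f (M + 1)) => // m.
    (* the index must be positive and large enough for a to be admissible *)
    exists (maxn m N).+1, (x (maxn m N).+1); split.
    - by rewrite leqW// leq_maxl.
    - apply: xmin => //; exists a; apply: truncation_subset Na.
      by rewrite leqW// leq_maxr.
    - by apply: xM => //; rewrite ltrDl.
  have [phi [w [d [[phi_incr _] _ [d0 _] wmin wd]]]] :=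
    cond (ex_intro _ x (conj unb xmin)).
  have phi_ge k : (k <= phi k)%N.
    by elim: k => // k IH; apply: leq_ltn_trans IH (phi_incr _ _ _).
  have [wy|] := pselect ((fun k => `|w k|) @ \oo --> +oo).
    exfalso; apply: (nodir d d0) => y Ky; apply: asymptotic_cone_normalized wd => //.
    have [m ym _] := truncation_mem 0 Ky.
    exists m => // k /= mk; have [[Kw _] minw] := wmin k; split => //.
    exact/minw/(truncation_subset (leq_trans mk (phi_ge k))).
  move/cvgryPge/existsNP => -[M wM].
  apply: (@argmin_of_bounded_argmins R X K f M) => // m.
  apply: contra_notP wM => nex; exists m => // k /= mk.
  rewrite leNgt; apply/negP => wkM; apply: nex; exists (phi k), (w k); split => //.
    exact: leq_trans (phi_ge k).
  exact: ltW.
split => //; apply/seteqP; split=> [u uinf|_ ->]; last exact: asymptotic_cone0.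
apply: contrapT => /eqP u0; apply: (nodir u u0) => y Ky.
by apply: asymptotic_cone_sub uinf => x [Kx minx]; split => //; exact: minx.
Qed.
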